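(* For every $n\ge1$, the number $\Delta_n$ of $DIII$ $(n,n)$-clans is $$\Delta_n=\sum_{r=0}^{\lfloor n/2\rfloor}2^{\,n-2r-1}\frac{n!}{r!\,(n-2r)!}.$$
   Context: An $(n,n)$-clan is a string $\gamma=c_1\cdots c_{2n}$ of symbols from $\mathbb N\cup\{+,-\}$ with equally many $+$'s and $-$'s, in which every natural number that appears appears exactly twice; two clans are equal if they have the same signs at the same positions and the same positions of matching number pairs. $rev(\gamma)=c_{2n}\cdots c_1$, and $\overline\gamma$ is obtained by exchanging $+$ and $-$. A $DIII$ $(n,n)$-clan is an $(n,n)$-clan such that (i) $\gamma=rev(\overline\gamma)$; (ii) if $c_i\in\mathbb N$ then $c_i\ne c_{2n+1-i}$; (iii) the number of $-$'s among $c_1,\dots,c_n$ plus the number of pairs $i<j\le n$ with $c_i=c_j\in\mathbb N$ is even. *)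

(* Defs.v *)
From HB Require Import structures.
From mathcomp Require Import all_boot.
From mathcomp Require Import generic_quotient.

Set Implicit Arguments.
Unset Strict Implicit.
Unset Printing Implicit Defensive.

Notation symbol := (bool + nat)%type.
Definition plus : symbol := inl true.
Definition minus : symbol := inl false.
Definition is_num (c : symbol) : bool := if c is inr _ then true else false.
Definition flip_sign (c : symbol) : symbol :=
  if c is inl b then inl (~~ b) else c.

(* The letter c_k of the word w = c_1 ... c_2n is [tnth w i] with i = k - 1;
   thus c_(2n+1-k) is [tnth w (rev_ord i)], and k <= n is i < n. *)
Notation word n := ((n + n).-tuple symbol).

Section Words.
Variable n : nat.
Implicit Types v w : word n.

Definition is_clan_word w : bool :=
  (count_mem plus w == count_mem minus w) &&
  all (fun c => is_num c ==> (count_mem c w == 2)) w.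

Definition matched w (i j : 'I_(n + n)) : bool :=
  [&& i != j, is_num (tnth w i) & tnth w i == tnth w j].

Definition same_clan v w : bool :=
  [forall i, forall b, (tnth v i == inl b) == (tnth w i == inl b)] &&
  [forall i, forall j, matched v i j == matched w i j].

Definition word_rev w : word n := [tuple of rev w].
Definition word_flip w : word n := [tuple of map flip_sign w].

Definition DIII_word w : bool :=
  [&& same_clan w (word_rev (word_flip w)),
      [forall i, is_num (tnth w i) ==> (tnth w i != tnth w (rev_ord i))] &
      ~~ odd (#|[set i : 'I_(n + n) | (i < n) && (tnth w i == minus)]| +
              #|[set p : 'I_(n + n) * 'I_(n + n) |
                 [&& p.1 < p.2, p.2 < n, is_num (tnth w p.1) &
                     tnth w p.1 == tnth w p.2]]|)].

Lemma same_clanP v w :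
  reflect ((forall i b, (tnth v i == inl b) = (tnth w i == inl b)) /\
           (forall i j, matched v i j = matched w i j)) (same_clan v w).
Proof.
apply: (iffP andP) => -[h1 h2]; split.
- by move=> i b; move: h1 => /forallP/(_ i)/forallP/(_ b)/eqP.
- by move=> i j; move: h2 => /forallP/(_ i)/forallP/(_ j)/eqP.
- by apply/forallP => i; apply/forallP => b; rewrite h1.
- by apply/forallP => i; apply/forallP => j; rewrite h2.
Qed.

Lemma same_clan_refl : reflexive same_clan.
Proof. by move=> w; apply/same_clanP. Qed.

Lemma same_clan_sym : symmetric same_clan.
Proof. by move=> v w; apply/same_clanP/same_clanP => -[h1 h2]; split. Qed.

Lemma same_clan_trans : transitive same_clan.
Proof.
move=> v u w /same_clanP[h1 h2] /same_clanP[h3 h4].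
by apply/same_clanP; split=> *; rewrite ?h1 ?h2.
Qed.

Lemma tnth_word_rev w i : tnth (word_rev w) i = tnth w (rev_ord i).
Proof.
rewrite (tnth_nth plus) /= nth_rev ?size_tuple ?ltn_ord //.
by rewrite (tnth_nth plus).
Qed.

Lemma rev_ord_neq (i : 'I_(n + n)) : i != rev_ord i.
Proof.
apply/eqP => /(congr1 val) /= e.
have: i + i.+1 = n + n by rewrite {1}e subnK.
by move/(congr1 odd); rewrite addnS oddS !oddD !addbb.
Qed.

Lemma same_clan_rev v w : same_clan v w -> same_clan (word_rev v) (word_rev w).
Proof.
move=> /same_clanP[h1 h2]; apply/same_clanP; split=> [i b|i j].
  by rewrite !tnth_word_rev.
have := h2 (rev_ord i) (rev_ord j).
by rewrite /matched !tnth_word_rev (inj_eq rev_ord_inj).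
Qed.

Lemma matched_flip w i j : matched (word_flip w) i j = matched w i j.
Proof. by rewrite /matched !tnth_map; do 2!case: (tnth w _) => ?. Qed.

Lemma same_clan_flip v w :
  same_clan v w -> same_clan (word_flip v) (word_flip w).
Proof.
move=> /same_clanP[h1 h2]; apply/same_clanP; split=> [i b|i j]; last first.
  by rewrite !matched_flip.
have e (c : symbol) : (flip_sign c == inl b) = (c == inl (~~ b)).
  by case: c => // -[]; case: b.
by rewrite !tnth_map !e.
Qed.

Lemma DIII_word_compat v w : same_clan v w -> DIII_word v = DIII_word w.
Proof.
move=> vw; have /same_clanP[h1 h2] := vw; congr [&& _, _ & _].
- have rvw := same_clan_rev (same_clan_flip vw).
  apply/idP/idP => h.
    by rewrite same_clan_sym in vw; apply: same_clan_trans vw _;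
       apply: same_clan_trans h rvw.
  rewrite same_clan_sym in rvw.
  by apply: same_clan_trans vw _; apply: same_clan_trans h rvw.
- apply: eq_forallb => i; have := h2 i (rev_ord i).
  by rewrite /matched rev_ord_neq /= !implybE -!negb_and => ->.
- congr (~~ odd (_ + _)); apply: eq_card => p; rewrite !inE ?h1 //.
  case: ltnP => //= lt; have := h2 p.1 p.2.
  by rewrite /matched -val_eqE neq_ltn lt /= => ->.
Qed.

End Words.

Record clan_word n := ClanWord {
  letters :> word n;
  lettersP : is_clan_word letters
}.
HB.instance Definition _ n := [isSub for @letters n].
HB.instance Definition _ n := [Countable of clan_word n by <:].

Definition same_clan_sub n (v w : clan_word n) : bool :=
  same_clan v w.

Lemma same_clan_sub_refl n : reflexive (@same_clan_sub n).
Proof. by move=> w; apply: same_clan_refl. Qed.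
Lemma same_clan_sub_sym n : symmetric (@same_clan_sub n).
Proof. by move=> v w; apply: same_clan_sym. Qed.
Lemma same_clan_sub_trans n : transitive (@same_clan_sub n).
Proof. by move=> v u w; apply: same_clan_trans. Qed.

Canonical same_clan_sub_equiv n :=
  EquivRel (@same_clan_sub n) (@same_clan_sub_refl n) (@same_clan_sub_sym n)
    (@same_clan_sub_trans n).

Local Open Scope quotient_scope.

(* An (n,n)-clan; Leibniz equality on this type is equality of clans. *)
Definition clan n := {eq_quot @same_clan_sub n}.
HB.instance Definition _ n := Countable.on (clan n).
HB.instance Definition _ n := EqQuotient.on (clan n).

(* [clan n] is finite: relabel every number of a word by the first position
   where it occurs. *)
Section Finite.
Variable n : nat.

Definition code (c : clan n) : (n + n).-tuple (bool + 'I_(n + n).+1) :=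
  [tuple of map (fun x : symbol => match x with
                          | inl b => inl b
                          | inr _ => inr (inord (index x (repr c)))
                          end) (repr c)].

Definition decode (t : (n + n).-tuple (bool + 'I_(n + n).+1)) :
  option (clan n) :=
  omap \pi_(clan n) (insub [tuple of map (fun x => match x with
                          | inl b => inl b
                          | inr i => inr (val i)
                          end : symbol) t] : option (clan_word n)).

Lemma codeK : pcancel code decode.
Proof.
move=> c; rewrite /decode; set t := [tuple of _].
set w := repr c; have ws := lettersP w; set u := letters w in ws.
pose phi (x : symbol) : symbol := if x is inl b then inl b else inr (index x u).
have te : val t = map phi u.
  rewrite /= -map_comp; apply: eq_map => -[b|k] //=.
  by rewrite inordK // ltnS -[X in _ <= X](size_tuple u) index_size.
have phi_num x : is_num (phi x) = is_num x by case: x.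
have phi_inl x b : (phi x == inl b) = (x == inl b) by case: x.
have phi_inj : {in u &, injective phi}.
  move=> [b|k] [b'|k'] //= ku k'u [] // /(congr1 (nth plus u)).
  by rewrite !nth_index.
have cnt x : x \in u -> count_mem (phi x) (map phi u) = count_mem x u.
  move=> xu; rewrite count_map; apply: eq_in_count => y yu /=.
  by rewrite (inj_in_eq phi_inj).
have tc : is_clan_word t.
  rewrite /is_clan_word te !count_map.
  case/andP: ws => /eqP h1 /allP h2; apply/andP; split.
    apply/eqP; transitivity (count_mem plus u).
      by apply: eq_count => x /=; rewrite phi_inl.
    by rewrite h1; apply: eq_count => x /=; rewrite phi_inl.
  apply/allP => _ /mapP[x xu ->]; rewrite phi_num cnt //; exact: h2.
rewrite (insubT (@is_clan_word n) tc) /=; congr Some.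
rewrite -[RHS]reprK -/w; apply/eqP; rewrite eqmodE /= /same_clan_sub SubK -/u.
have tn i : tnth t i = phi (tnth u i).
  by rewrite !(tnth_nth plus) te (nth_map plus) ?size_tuple.
apply/same_clanP; split=> [i b|i j]; rewrite /matched ?tn ?phi_inl //.
by rewrite phi_num (inj_in_eq phi_inj) ?mem_tnth.
Qed.

HB.instance Definition _ : isFinite (clan n) := PCanIsFinite codeK.
End Finite.

(* Well defined on clans: see [DIII_clan_pi]. *)
Definition DIII_clan n (c : clan n) : bool := DIII_word (repr c).

Lemma eq_clanE n (v w : clan_word n) :
  (\pi_(clan n) v == \pi_(clan n) w) = same_clan v w.
Proof. exact: (eqmodE (same_clan_sub_equiv n)). Qed.

Lemma DIII_clan_pi n (w : clan_word n) :
  DIII_clan (\pi_(clan n) w) = DIII_word w.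
Proof. by apply: DIII_word_compat; rewrite -eq_clanE reprK. Qed.

Definition DIII_number n : nat := #|[set c : clan n | DIII_clan c]|.

(* Main.v *)
(* A DIII clan is symmetric under reversal, so it is determined by its first
   half together with, for each number there, whether its mate lies in the same
   half or in the other one.  This is a signed involution of [n]: an involution
   with a sign on each orbit (minus, resp. same half, being [true]), and
   condition (iii) says that the number of orbits marked [true] is even.
   Removing the orbit of a fixed element a, whose mark is arbitrary, shows that
   the two parities are equally frequent and that the total T(m) satisfies
   T(m+2) = 2 T(m+1) + 2 (m+1) T(m), which the sum satisfies termwise. *)
Require Import Defs.
From mathcomp Require Import all_boot all_order all_algebra.
From mathcomp Require Import generic_quotient ring.

(** * Occurrence counts and parities of finite sets *)

Lemma count_mem_tnth (T : eqType) m (w : m.-tuple T) (c : T) :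
  count_mem c w = #|[set i | tnth w i == c]|.
Proof.
rewrite -[in LHS](map_tnth_enum w) count_map cardsE cardE size_filter enumT.
by apply: eq_count.
Qed.

Lemma odd_card (T : finType) (A : {set T}) :
  odd #|A| = \big[addb/false]_i (i \in A).
Proof.
rewrite -sum1_card (big_morph odd oddD (erefl _)) big_mkcond.
by apply: eq_bigr => i _; case: ifP.
Qed.

(** * Signed involutions: counting by removal of an orbit *)

Section SignedInvolutions.
Set Implicit Arguments.
Unset Strict Implicit.
Variable n : nat.
Implicit Types (A : {set 'I_n}) (g : {ffun 'I_n -> 'I_n * bool}).

(** The first clause says at once that the underlying map is an involution and that the mark is
    constant on orbits. Outside [A] the map is the identity with mark [false], so that all subsets
    [A] share one function type. *)
Definition signed_inv_on A g : bool :=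
  [forall i, g (g i).1 == (i, (g i).2)] &&
  [forall (i | i \notin A), g i == (i, false)].

(** Each orbit contributes its mark once, at its least element. *)
Definition sparity g : bool :=
  \big[addb/false]_(i < n) ((i <= (g i).1) && (g i).2).

Definition signed_inv_card A (e : bool) : nat :=
  #|[set g | signed_inv_on A g && (sparity g == e)]|.

Definition signed_inv_total A : nat :=
  signed_inv_card A false + signed_inv_card A true.

Definition detach a b g : {ffun 'I_n -> 'I_n * bool} :=
  [ffun i => if (i == a) || (i == b) then (i, false) else g i].

(** The case [b = a] is included and creates a fixed point. *)
Definition attach a b c g : {ffun 'I_n -> 'I_n * bool} :=
  [ffun i => if i == a then (b, c) else if i == b then (a, c) else g i].

Lemma signed_inv_onP A g :
  reflect ((forall i, g (g i).1 = (i, (g i).2)) /\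
           (forall i, i \notin A -> g i = (i, false)))
          (signed_inv_on A g).
Proof.
apply: (iffP andP) => -[h1 h2]; split.
- by move=> i; apply/eqP/(forallP h1).
- by move=> i iA; apply/eqP; apply: (forall_inP h2).
- by apply/forallP => i; apply/eqP.
- by apply/forall_inP => i iA; apply/eqP/h2.
Qed.

Lemma attachK {A a b c g} :
  signed_inv_on (A :\ a :\ b) g -> detach a b (attach a b c g) = g.
Proof.
case/signed_inv_onP => _ h; apply/ffunP => i; rewrite !ffunE.
case: eqP => [->|_] /=; first by rewrite h // !inE eqxx andbF.
by case: eqP => [->|_] //=; rewrite h // !inE eqxx.
Qed.

Lemma detachK {A a b c g} :
  signed_inv_on A g -> g a = (b, c) -> attach a b c (detach a b g) = g.
Proof.
case/signed_inv_onP => h _ ga; apply/ffunP => i; rewrite !ffunE.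
case: eqP => [->|_] //=; case: eqP => [->|_] //=.
by have := h a; rewrite ga.
Qed.

Lemma signed_inv_detach {A a b c g} :
  signed_inv_on A g -> g a = (b, c) ->
  signed_inv_on (A :\ a :\ b) (detach a b g).
Proof.
case/signed_inv_onP => h1 h2 ga; have gb := h1 a; rewrite ga /= in gb.
apply/signed_inv_onP; split=> i; rewrite !ffunE; last first.
  rewrite !inE; case: (i == a); case: (i == b) => //=; exact: h2.
have [ab|/norP[/negPf ia /negPf ib]] := boolP ((i == a) || (i == b)).
  by rewrite /= ab.
case: ifP => [/orP[]/eqP e|_]; last exact: h1.
- by have := h1 i; rewrite e ga => -[eb]; rewrite eb eqxx in ib.
- by have := h1 i; rewrite e gb => -[ea]; rewrite ea eqxx in ia.
Qed.

(** Both [a] and [b] are fixed by [g], so an involution cannot send any other point to them. *)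
Lemma detached_image {A a b g i} :
  signed_inv_on (A :\ a :\ b) g -> i != a -> i != b ->
  ((g i).1 != a) && ((g i).1 != b).
Proof.
case/signed_inv_onP => h1 h2 ia ib.
have ga : g a = (a, false) by apply: h2; rewrite !inE eqxx andbF.
have gb : g b = (b, false) by apply: h2; rewrite !inE eqxx.
apply/andP; split; apply/eqP => e; have := h1 i; rewrite e.
- by rewrite ga => -[ea]; rewrite ea eqxx in ia.
- by rewrite gb => -[eb]; rewrite eb eqxx in ib.
Qed.

Lemma signed_inv_attach {A a b c g} : a \in A -> b \in A ->
  signed_inv_on (A :\ a :\ b) g -> signed_inv_on A (attach a b c g).
Proof.
move=> aA bA hg; have /signed_inv_onP[h1 h2] := hg.
apply/signed_inv_onP; split=> i; rewrite !ffunE; last first.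
  case: eqP => [->|_]; first by rewrite aA.
  case: eqP => [->|_]; first by rewrite bA.
  by move=> iA; rewrite h2 // !inE (negPf iA) !andbF.
have [->|ia] := eqVneq i a; first by rewrite /= eqxx; case: eqVneq => // ->.
have [->|ib] := eqVneq i b; first by rewrite /= eqxx.
by have /andP[/negPf-> /negPf->] := detached_image hg ia ib.
Qed.

Lemma sparity_attach {A a b c g} :
  signed_inv_on (A :\ a :\ b) g -> sparity (attach a b c g) = c (+) sparity g.
Proof.
case/signed_inv_onP => h1 h2.
have ga : g a = (a, false) by apply: h2; rewrite !inE eqxx andbF.
have gb : g b = (b, false) by apply: h2; rewrite !inE eqxx.
rewrite /sparity (bigD1 a) //= [in RHS](bigD1 a) //= ffunE eqxx ga andbF addFb.
have [<-|ba] := eqVneq b a.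
  rewrite leqnn /=; congr (_ (+) _); apply: eq_bigr => i /negPf ia.
  by rewrite ffunE ia.
rewrite (bigD1 b) //= [in RHS](bigD1 b) //= ffunE eqxx (negPf ba) gb andbF.
rewrite addFb addbA; congr (_ (+) _).
  (* Exactly one of [a <= b] and [b <= a] holds, so the new orbit contributes [c] only once. *)
  rewrite /=; case: c; rewrite ?andbF //= !andbT.
  by case: ltngtP => // /val_inj e; rewrite e eqxx in ba.
by apply: eq_bigr => i /andP[/negPf ia /negPf ib]; rewrite ffunE ia ib.
Qed.

(** [attach] and [detach] are inverse bijections here, and the removed orbit shifts the parity by
    its mark [c]. *)
Lemma signed_inv_card_fiber A a b c e : a \in A -> b \in A ->
  #|[set g | [&& signed_inv_on A g, sparity g == e & g a == (b, c)]]| =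
  signed_inv_card (A :\ a :\ b) (e (+) c).
Proof.
move=> aA bA; rewrite /signed_inv_card -!sum1dep_card.
rewrite (reindex_onto (attach a b c) (detach a b)) /=; last first.
  by move=> g /and3P[h _ /eqP ga]; exact: (detachK h ga).
apply: eq_bigl => g; have -> : attach a b c g a == (b, c) by rewrite ffunE eqxx.
rewrite andbT.
apply/andP/andP => [[/andP[hg /eqP <-] /eqP gE]|[hg /eqP gE]].
  have ga : attach a b c g a = (b, c) by rewrite ffunE eqxx.
  have hg' := signed_inv_detach hg ga; rewrite gE in hg'.
  by rewrite (sparity_attach hg') addbAC addbb.
rewrite (attachK hg) (signed_inv_attach aA bA hg) (sparity_attach hg) gE.
by rewrite addbC -addbA addbb addbF !eqxx.
Qed.

(** Sort by the value of [g] at [a]. The right-hand side is free of [e], which is the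
    equidistribution of the two parities on a nonempty set. *)
Lemma signed_inv_card_rec A a e : a \in A ->
  signed_inv_card A e = \sum_(b in A) signed_inv_total (A :\ a :\ b).
Proof.
move=> aA; rewrite {1}/signed_inv_card -sum1dep_card.
rewrite (partition_big (fun g => g a) (fun p => p.1 \in A)) /=; last first.
  (* An image of [a] outside [A] would be fixed by [g], hence equal to [a], which lies in [A]. *)
  move=> g /andP[/signed_inv_onP[h1 h2] _]; apply/negPn/negP => gA.
  by have := h1 a; rewrite h2 //= => -[ea]; rewrite ea aA in gA.
pose F (b : 'I_n) (c : bool) := signed_inv_card (A :\ a :\ b) (e (+) c).
rewrite (eq_bigr (fun p => F p.1 p.2)); last first.
  move=> [b c] /= bA; rewrite /F -(signed_inv_card_fiber _ _ aA bA).
  by rewrite -sum1dep_card; apply: eq_bigl => g; rewrite andbA.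
rewrite (eq_bigl (fun p => (p.1 \in A) && true)) => [|p]; last by rewrite andbT.
rewrite -(pair_big (mem A) xpredT F) /=; apply: eq_bigr => b _.
(* As [c] takes both values, [e (+) c] runs through both parities. *)
rewrite big_bool {}/F addbT addbF /signed_inv_total.
by case: e; rewrite //= addnC.
Qed.

Lemma signed_inv_total0 : signed_inv_total set0 = 1.
Proof.
pose g0 : {ffun 'I_n -> 'I_n * bool} := [ffun i => (i, false)].
have E e : [set g | signed_inv_on set0 g && (sparity g == e)] =
           if e then set0 else [set g0].
  have p0 : sparity g0 = false.
    by rewrite /sparity big1 // => i _; rewrite ffunE andbF.
  apply/setP => g; rewrite inE.
  have -> : signed_inv_on set0 g = (g == g0).
    apply/signed_inv_onP/eqP => [[_ h]|->].
      by apply/ffunP => i; rewrite ffunE h ?inE.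
    by split=> i; rewrite !ffunE.
  have [->|h] := eqVneq g g0; first by rewrite p0; case: e; rewrite !inE ?eqxx.
  by case: e; rewrite !inE // (negPf h).
by rewrite /signed_inv_total /signed_inv_card !E cards0 cards1.
Qed.
End SignedInvolutions.

(** * Positions as a letter of the first half together with a choice of half *)

Section Positions.
Set Implicit Arguments.
Unset Strict Implicit.
Variable n : nat.
Implicit Types (p q : 'I_(n + n)) (x : 'I_n * bool).

(* [pos (i, false)] is the letter [i] of the first half and [pos (i, true)] its
   mirror image, so that [rev_ord] negates the second component. *)
Definition pos x : 'I_(n + n) :=
  if x.2 then rshift n (rev_ord x.1) else lshift n x.1.

Arguments pos : simpl never.

Definition loc p : 'I_n * bool :=
  match split p with inl i => (i, false) | inr j => (rev_ord j, true) end.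

Lemma posK : cancel pos loc.
Proof.
case=> i [].
- rewrite /pos /loc /= -[rshift _ _]/(unsplit (inr (rev_ord i))) unsplitK.
  by rewrite rev_ordK.
- by rewrite /pos /loc /= -[lshift _ _]/(unsplit (inl i)) unsplitK.
Qed.

Lemma locK : cancel loc pos.
Proof.
move=> p; rewrite -[RHS]splitK /loc /pos.
by case: (split p) => i //=; rewrite rev_ordK.
Qed.

Lemma pos_inj : injective pos. Proof. exact: can_inj posK. Qed.

Lemma rev_pos x : rev_ord (pos x) = pos (x.1, ~~ x.2).
Proof.
have E i : rev_ord (lshift n i) = rshift n (rev_ord i).
  by apply: val_inj; rewrite /= addnBA.
case: x => i []; rewrite /pos /= ?E //.
by apply: rev_ord_inj; rewrite rev_ordK E.
Qed.

Lemma loc_rev p : loc (rev_ord p) = ((loc p).1, ~~ (loc p).2).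
Proof. by rewrite -[in LHS](locK p) rev_pos posK. Qed.

Lemma pos_lt x : (pos x < n) = ~~ x.2.
Proof. by case: x => i []; rewrite /pos /= ?ltn_ord // ltnNge leq_addr. Qed.

Lemma posP p : exists x, p = pos x.
Proof. by exists (loc p); rewrite locK. Qed.
End Positions.

(** * The clan word of an involution that commutes with reversal *)

Section WordOfInvolution.
Set Implicit Arguments.
Unset Strict Implicit.
Variables (n : nat) (t : 'I_(n + n) -> 'I_(n + n)).
Implicit Types p q : 'I_(n + n).

Definition paired p := (t p != p) && (t p != rev_ord p).

(* A pair of opposite signs at [p] and [rev_ord p] is encoded in [t] by fixing
   or exchanging the two positions, neither of which a number may do. *)
Definition inv_word : word n :=
  [tuple if paired p then inr (minn p (t p))
         else inl ((loc p).2 (+) (t p != p)) | p < n + n].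

Hypotheses (tK : involutive t)
  (t_rev : forall p, t (rev_ord p) = rev_ord (t p)).

Lemma inv_word_num p : is_num (tnth inv_word p) = paired p.
Proof. by rewrite tnth_mktuple; case: ifP. Qed.

Lemma inv_word_sign p b :
  (tnth inv_word p == inl b) = ~~ paired p && (b == (loc p).2 (+) (t p != p)).
Proof. by rewrite tnth_mktuple; case: ifP => //= _; rewrite eq_sym. Qed.

Lemma paired_t p : paired (t p) = paired p.
Proof.
rewrite /paired tK eq_sym; congr (_ && ~~ _).
by rewrite -(inj_eq rev_ord_inj) rev_ordK eq_sym.
Qed.

Lemma paired_rev p : paired (rev_ord p) = paired p.
Proof. by rewrite /paired t_rev !(inj_eq rev_ord_inj). Qed.

(** The label of a number is the least position of its orbit under [t], so equal labels mean equal
    orbits. *)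
Lemma inv_word_matched p q :
  matched inv_word p q = paired p && (q == t p).
Proof.
rewrite /matched inv_word_num; have [pp|] := boolP (paired p);
  last by rewrite andbF.
rewrite /= !tnth_mktuple pp; have [->|qtp] := eqVneq q (t p).
  by rewrite paired_t pp tK minnC eqxx andbT eq_sym; case/andP: pp.
apply/negbTE; rewrite negb_and negbK; have [//|pq] := eqVneq p q.
(* Equal minima would identify one of [p], [t p] with one of [q], [t q]; all four coincidences are
   excluded. *)
case: ifP => //= _; apply/eqP => -[] /eqP; rewrite /minn.
have t_inj := can_inj tK.
have tpq : t p != t q by rewrite (inj_eq t_inj).
have ptq : p != t q by rewrite -(inj_eq t_inj) tK eq_sym.
rewrite eq_sym in qtp.
by do 2!case: ifP => _; rewrite val_eqE;
   rewrite ?(negPf pq) ?(negPf ptq) ?(negPf qtp) ?(negPf tpq).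
Qed.

Lemma inv_word_sign_rev p b :
  (tnth inv_word (rev_ord p) == inl b) = (tnth inv_word p == inl (~~ b)).
Proof.
rewrite !inv_word_sign paired_rev loc_rev t_rev (inj_eq rev_ord_inj) /=.
by case: b (_.2) (t p != p) => [] [] [].
Qed.

(** Reversal carries the plus positions bijectively onto the minus positions, and the positions
    bearing a given number form one orbit [[set p; t p]]. *)
Lemma inv_word_clan : is_clan_word inv_word.
Proof.
apply/andP; split; rewrite ?count_mem_tnth.
  rewrite -(card_preimset _ (@rev_ord_inj (n + n))); apply/eqP/eq_card => p.
  by rewrite !inE inv_word_sign_rev.
apply/allP => _ /tnthP[p ->]; apply/implyP => pn; rewrite count_mem_tnth.
have pp : paired p by rewrite -inv_word_num.
have <- : #|[set p; t p]| = 2.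
  by rewrite cards2 eq_sym; case/andP: pp => ->.
apply/eqP/eq_card => q; rewrite !inE; have := inv_word_matched p q.
rewrite /matched pn pp eq_sym (eq_sym (tnth _ q)).
by have [->|_] := eqVneq q p; rewrite ?eqxx.
Qed.
End WordOfInvolution.

(** * Conditions (i) and (ii), and their description by involutions *)

Section Symmetry.
Set Implicit Arguments.
Unset Strict Implicit.
Variable n : nat.
Implicit Types (w : word n) (p q : 'I_(n + n)).

Lemma matched_rev w p q :
  matched (word_rev w) p q = matched w (rev_ord p) (rev_ord q).
Proof. by rewrite /matched !tnth_word_rev (inj_eq rev_ord_inj). Qed.

Lemma same_clan_rev_flipP w :
  reflect ((forall p b,
             (tnth w (rev_ord p) == inl b) = (tnth w p == inl (~~ b))) /\
           (forall p q, matched w (rev_ord p) (rev_ord q) = matched w p q))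
          (same_clan w (word_rev (word_flip w))).
Proof.
have flipE (c : symbol) b : (flip_sign c == inl b) = (c == inl (~~ b)).
  by case: c => // -[]; case: b.
have rfE p b : (tnth (word_rev (word_flip w)) p == inl b) =
               (tnth w (rev_ord p) == inl (~~ b)).
  by rewrite tnth_word_rev tnth_map flipE.
apply: (iffP (same_clanP _ _)) => -[h1 h2]; split.
- by move=> p b; rewrite h1 rfE rev_ordK.
- by move=> p q; rewrite h2 matched_rev matched_flip !rev_ordK.
- by move=> p b; rewrite rfE h1 negbK.
- by move=> p q; rewrite matched_rev matched_flip h2.
Qed.

Lemma matchedC w p q : matched w p q = matched w q p.
Proof.
rewrite /matched eq_sym; case: eqP => //= _; rewrite eq_sym.
by case: eqP => [->|]; rewrite ?andbF.
Qed.

(** Conditions (i) and (ii) alone: these characterize the words of symmetric involutions, while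
    (iii) becomes a parity. *)
Definition DIII_symmetric w : bool :=
  same_clan w (word_rev (word_flip w)) &&
  [forall i, is_num (tnth w i) ==> (tnth w i != tnth w (rev_ord i))].

Definition minus_or_pair_count w : nat :=
  #|[set i : 'I_(n + n) | (i < n) && (tnth w i == minus)]| +
  #|[set p : 'I_(n + n) * 'I_(n + n) |
      [&& p.1 < p.2, p.2 < n, is_num (tnth w p.1) & tnth w p.1 == tnth w p.2]]|.

Lemma DIII_wordE w :
  DIII_word w = DIII_symmetric w && ~~ odd (minus_or_pair_count w).
Proof. by rewrite /DIII_word andbA. Qed.

Lemma inv_word_symmetric (t : 'I_(n + n) -> 'I_(n + n)) :
  involutive t -> (forall p, t (rev_ord p) = rev_ord (t p)) ->
  DIII_symmetric (inv_word t).
Proof.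
move=> tK t_rev; apply/andP; split.
  apply/same_clan_rev_flipP; split=> [p b|p q].
    exact: inv_word_sign_rev.
  by rewrite !inv_word_matched // paired_rev // t_rev (inj_eq rev_ord_inj).
apply/forallP => p; apply/implyP => pn; apply/negP => e.
have: matched (inv_word t) p (rev_ord p) by rewrite /matched rev_ord_neq pn e.
by rewrite inv_word_matched // => /andP[/andP[_]]; rewrite eq_sym => /negPf->.
Qed.

Lemma clan_word_partner w p : is_clan_word w -> is_num (tnth w p) ->
  exists q, matched w p =1 pred1 q.
Proof.
case/andP => _ /allP h pn; have := h _ (mem_tnth p w); rewrite pn /=.
rewrite count_mem_tnth => /cards2P[a [b [ab E]]].
have hE q : matched w p q = (q != p) && (q \in [set a; b]).
  by rewrite -E inE /matched pn eq_sym (eq_sym (tnth w q)).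
have: p \in [set a; b] by rewrite -E inE.
rewrite !inE => /orP[]/eqP pE.
  exists b => q; rewrite hE !inE pE /=.
  by have [->|] := eqVneq q a; rewrite ?(negPf ab).
exists a => q; rewrite hE !inE pE /=.
by have [->|] := eqVneq q b; rewrite ?orbF // eq_sym (negPf ab).
Qed.

(** Converse of [inv_word_symmetric], up to relabelling of numbers: [t] sends a number to its mate,
    and fixes a sign or sends it to its mirror position according to its value. *)
Lemma DIII_symmetric_inv_word w : is_clan_word w -> DIII_symmetric w ->
  exists t : 'I_(n + n) -> 'I_(n + n),
    [/\ involutive t, forall p, t (rev_ord p) = rev_ord (t p) &
        same_clan (inv_word t) w].
Proof.
move=> wc /andP[/same_clan_rev_flipP[sgn_rev mat_rev] /forallP nrev].
pose t p := if is_num (tnth w p) then odflt p [pick q | matched w p q]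
            (* In the first half [(loc p).2] is [false], so a minus is fixed and a plus exchanged;
               in the second half the roles are swapped. *)
            else if tnth w p == inl (loc p).2 then p else rev_ord p.
have tnum p : is_num (tnth w p) -> matched w p =1 pred1 (t p).
  move=> pn; rewrite /t pn; have [r rE] := clan_word_partner wc pn.
  case: pickP => [q|] /=.
    by rewrite rE => /eqP -> x; rewrite rE.
  by move/(_ r); rewrite rE /= eqxx.
have num_rev p : is_num (tnth w (rev_ord p)) = is_num (tnth w p).
  (* [sgn_rev] speaks of signs only, so a number is described as the absence of a sign. *)
  have H q : is_num (tnth w q) = ~~ [exists b, tnth w q == inl b].
    apply/idP/existsPn => [|h]; first by case: (tnth w q).
    by case E: (tnth w q) (h) => [b|//] => /(_ b); rewrite eqxx.
  rewrite !H; congr (~~ _); apply/existsP/existsP => -[b].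
    by rewrite sgn_rev; exists (~~ b).
  by exists (~~ b); rewrite sgn_rev negbK.
have t_rev p : t (rev_ord p) = rev_ord (t p).
  have [pn|pn] := boolP (is_num (tnth w p)).
    have rn : is_num (tnth w (rev_ord p)) by rewrite num_rev.
    apply/esym/eqP; rewrite -[_ == _]/(pred1 _ _) -(tnum _ rn) mat_rev.
    by rewrite (tnum _ pn) /=.
  rewrite /t num_rev (negPf pn) loc_rev sgn_rev /= negbK.
  by case: ifP.
have tK : involutive t.
  move=> p; have [pn|pn] := boolP (is_num (tnth w p)).
    have m : matched w p (t p) by rewrite (tnum _ pn) /=.
    have tn : is_num (tnth w (t p)).
      by case/and3P: m => _ _ /eqP <-.
    by apply/esym/eqP; rewrite -[_ == _]/(pred1 _ _) -(tnum _ tn) matchedC.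
  have [e|e] := eqVneq (t p) p; first by rewrite !e.
  have {}e : t p = rev_ord p.
    by move: e; rewrite /t (negPf pn); case: ifP; rewrite ?eqxx.
  by rewrite e t_rev e rev_ordK.
(* Condition (ii) enters here: the mate of a number is not its mirror position. *)
have pairedE p : paired t p = is_num (tnth w p).
  have [pn|pn] := boolP (is_num (tnth w p)).
    have m : matched w p (t p) by rewrite (tnum _ pn) /=.
    case/and3P: m; rewrite /paired eq_sym => -> _ /eqP e /=.
    by apply: contraTneq (implyP (nrev p) pn) => <-; rewrite -e eqxx.
  by rewrite /paired /t (negPf pn); case: ifP => _; rewrite eqxx ?andbF.
exists t; split=> //; apply/same_clanP; split=> [p b|p q]; last first.
  rewrite inv_word_matched // pairedE.
  have [pn|pn] := boolP (is_num (tnth w p)).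
    by rewrite (tnum _ pn).
  by rewrite /matched (negPf pn) andbF.
rewrite inv_word_sign pairedE /t.
case E: (tnth w p) => [c|k] //=.
rewrite !(inj_eq inl_inj).
have := rev_ord_neq p; rewrite eq_sym => /negPf r.
by case: c (loc p).2 b {E} => [] [] [] /=; rewrite ?eqxx ?r.
Qed.
End Symmetry.

(** * Bijection between DIII clans and signed involutions of even parity *)

Section SignedInvolutionClans.
Set Implicit Arguments.
Unset Strict Implicit.
Arguments pos {n} x : simpl never.
Variable n : nat.
Implicit Types (g : {ffun 'I_n -> 'I_n * bool}) (p : 'I_(n + n)).

Local Notation signed_inv g := (signed_inv_on [set: 'I_n] g).

(** The mark [true] keeps the half and [false] changes it. A fixed point of [g] marked [true] is
    thus fixed by [unfold g], giving a minus in the first half; one marked [false] gives a plus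
    there. *)
Definition unfold g p : 'I_(n + n) :=
  pos ((g (loc p).1).1, (loc p).2 (+) ~~ (g (loc p).1).2).

Lemma unfold_pos g i h :
  unfold g (pos (i, h)) = pos ((g i).1, h (+) ~~ (g i).2).
Proof. by rewrite /unfold posK. Qed.

Lemma unfold_inj g g' : unfold g =1 unfold g' -> g = g'.
Proof.
move=> e; apply/ffunP => i; have := e (pos (i, false)).
rewrite !unfold_pos => /pos_inj [].
by case: (g i) (g' i) => [j b] [j' b'] /= -> /negb_inj ->.
Qed.

Lemma unfoldK g : signed_inv g -> involutive (unfold g).
Proof.
case/signed_inv_onP => h _ p; have [[i b] ->] := posP p.
by rewrite !unfold_pos h /= -addbA addbb addbF.
Qed.

Lemma unfold_rev g p : unfold g (rev_ord p) = rev_ord (unfold g p).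
Proof. by rewrite /unfold loc_rev rev_pos addNb. Qed.

(** Commutation with [rev_ord] makes [t] determined by its values on the first half, from which [g]
    is read off. *)
Lemma ex_unfold (t : 'I_(n + n) -> 'I_(n + n)) :
  involutive t -> (forall p, t (rev_ord p) = rev_ord (t p)) ->
  exists2 g, signed_inv g & unfold g =1 t.
Proof.
move=> tK t_rev.
pose g : {ffun 'I_n -> 'I_n * bool} :=
  [ffun i => let x := loc (t (pos (i, false))) in (x.1, ~~ x.2)].
have gE : unfold g =1 t.
  move=> p; have [[i b] ->] := posP p; rewrite unfold_pos ffunE /= negbK.
  case: b => /=; last by rewrite -surjective_pairing locK.
  have -> : pos (i, true) = rev_ord (pos (i, false)) by rewrite rev_pos.
  by rewrite t_rev -[in RHS](locK (t _)) rev_pos.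
exists g => //; apply/signed_inv_onP; split=> i; last by rewrite inE.
have := tK (pos (i, false)).
rewrite -!gE (unfold_pos g i) unfold_pos => /pos_inj [].
by case: (g (g i).1) => [j b] /= ->; case: b (g i).2 => [] [].
Qed.

(** Minus signs of the first half are the fixed points marked [true]; pairs inside it are the
    two-element orbits marked [true], indexed by their smaller element. *)
Lemma odd_minus_or_pair_count g : signed_inv g ->
  odd (minus_or_pair_count (inv_word (unfold g))) = sparity g.
Proof.
move=> hg; have uK := unfoldK hg; have ur := unfold_rev g.
have pairE i : paired (unfold g) (pos (i, false)) = ((g i).1 != i).
  rewrite /paired unfold_pos rev_pos !(inj_eq (@pos_inj n)) /= !xpair_eqE.
  by case: eqP; case: (g i).2.
rewrite /minus_or_pair_count oddD.
have -> : [set p : 'I_(n + n) |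
            (p < n) && (tnth (inv_word (unfold g)) p == minus)] =
          [set pos (i, false) | i in [set i | ((g i).1 == i) && (g i).2]].
  apply/setP => p; rewrite inE inv_word_sign; apply/idP/imsetP.
    have [[i b] ->] := posP p; rewrite pos_lt; case: b => //=.
    rewrite pairE posK unfold_pos (inj_eq (@pos_inj n)) xpair_eqE negbK /=.
    case/andP => gi e; exists i => //; rewrite inE gi.
    by case: (g i).2 e; rewrite gi.
  case=> i; rewrite inE => /andP[gi gb] ->.
  by rewrite pos_lt pairE posK unfold_pos (inj_eq (@pos_inj n)) xpair_eqE gi gb.
have -> : [set p : 'I_(n + n) * 'I_(n + n) |
      [&& p.1 < p.2, p.2 < n, is_num (tnth (inv_word (unfold g)) p.1)
        & tnth (inv_word (unfold g)) p.1 == tnth (inv_word (unfold g)) p.2]] =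
    [set (pos (i, false), pos ((g i).1, false)) |
      i in [set i : 'I_n | (i < (g i).1) && (g i).2]].
  apply/setP => -[p q]; rewrite inE /=.
  have -> : [&& p < q, q < n, is_num (tnth (inv_word (unfold g)) p)
        & tnth (inv_word (unfold g)) p == tnth (inv_word (unfold g)) q] =
      [&& p < q, q < n & matched (inv_word (unfold g)) p q].
    by rewrite /matched -val_eqE neq_ltn; case: ltnP.
  rewrite inv_word_matched //; apply/idP/imsetP.
    case/and4P => pq qn pp /eqP qE; have pn := ltn_trans pq qn.
    have [[i b] pE] := posP p; move: pn pq qn; rewrite qE pE.
    rewrite pos_lt; case: b {pE} => // _.
    rewrite unfold_pos pos_lt negbK => pq gb.
    rewrite /= in gb; rewrite gb /= in pq *; exists i => //.
    by rewrite inE gb andbT.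
  case=> i; rewrite inE => /andP[ig gb] [-> ->].
  rewrite pairE unfold_pos gb /= eqxx andbT.
  by rewrite ltn_ord -val_eqE neq_ltn ig orbT.
rewrite !card_imset; last 2 first.
- by move=> i j /(congr1 fst) /pos_inj[].
- by move=> i j /pos_inj[].
(* The condition [i <= (g i).1] of [sparity] splits into the disjoint cases of equality and strict
   inequality. *)
rewrite !odd_card -big_split; apply: eq_bigr => i _; rewrite !inE -val_eqE /=.
by case: (g i).2; rewrite ?andbF // !andbT; case: ltngtP.
Qed.

Lemma inv_word_DIII g : signed_inv g ->
  DIII_word (inv_word (unfold g)) = (sparity g == false).
Proof.
move=> hg; rewrite DIII_wordE inv_word_symmetric.
- by rewrite odd_minus_or_pair_count // eqbF_neg.
- exact: unfoldK.
- exact: unfold_rev.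
Qed.

(** The matching recovers [unfold g] at numbers; at a sign, its value tells whether the position is
    fixed or exchanged with its mirror. *)
Lemma inv_word_inj g g' : signed_inv g -> signed_inv g' ->
  same_clan (inv_word (unfold g)) (inv_word (unfold g')) -> g = g'.
Proof.
move=> hg hg' /same_clanP[h1 h2]; apply: unfold_inj => p.
have [uK ur] := (unfoldK hg, unfold_rev g).
have [uK' ur'] := (unfoldK hg', unfold_rev g').
have mE q : paired (unfold g) p && (q == unfold g p) =
            paired (unfold g') p && (q == unfold g' p).
  by rewrite -!inv_word_matched.
have [pp|pp] := boolP (paired (unfold g) p).
  by have := mE (unfold g p); rewrite pp eqxx => /esym/andP[_ /eqP].
have pp' : ~~ paired (unfold g') p.
  by apply/negP => e; have := mE (unfold g' p); rewrite e eqxx (negPf pp).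
have := h1 p ((loc p).2 (+) (unfold g p != p)).
rewrite !inv_word_sign pp pp' eqxx /= => /esym/eqP/addbI.
move: pp pp'; rewrite /paired !negb_and !negbK.
case: (eqVneq (unfold g p) p) => [->|_];
  case: (eqVneq (unfold g' p) p) => [->|_] //=.
by move=> /eqP-> /eqP->.
Qed.

Local Open Scope quotient_scope.

Lemma inv_word_surj (c : clan n) : DIII_clan c ->
  exists2 g, signed_inv g && (sparity g == false) &
    same_clan (inv_word (unfold g)) (repr c).
Proof.
move=> cD; have wc := lettersP (repr c).
have := cD; rewrite /DIII_clan DIII_wordE => /andP[sym _].
have [t [tK t_rev tc]] := DIII_symmetric_inv_word wc sym.
have [g hg gE] := ex_unfold tK t_rev.
have E : inv_word (unfold g) = inv_word t.
  by apply: eq_from_tnth => p; rewrite !tnth_mktuple /paired gE.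
exists g; last by rewrite E.
rewrite hg -inv_word_DIII // E (DIII_word_compat tc); exact: cD.
Qed.

(** Made total in [g] by a default, the word of the identity, which consists of signs only;
    [clan_ofE] shows that it is not reached on signed involutions. *)
Definition clan_of g : clan n :=
  \pi_(clan n) (insubd
    (ClanWord (@inv_word_clan n id (fun=> erefl) (fun=> erefl)))
    (inv_word (unfold g))).

Lemma clan_ofE g (hg : signed_inv g) :
  clan_of g = \pi_(clan n)
    (ClanWord (inv_word_clan (unfoldK hg) (unfold_rev g))).
Proof.
congr (\pi_(clan n) _); apply: val_inj.
by rewrite val_insubd inv_word_clan //; [apply: unfoldK | apply: unfold_rev].
Qed.

Lemma DIII_number_signed_inv :
  DIII_number n = signed_inv_card [set: 'I_n] false.
Proof.
rewrite /DIII_number /signed_inv_card -[RHS](@card_in_imset _ _ clan_of).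
  apply: eq_card => c; rewrite inE; apply/idP/imsetP.
    case/inv_word_surj => g gP gc; exists g; first by rewrite inE.
    case/andP: gP => hg _; rewrite (clan_ofE hg) -[LHS]reprK; apply/eqP.
    by rewrite eq_clanE same_clan_sym.
  case=> g; rewrite inE => /andP[hg gP] ->.
  by rewrite (clan_ofE hg) DIII_clan_pi /= inv_word_DIII.
move=> g g'; rewrite !inE => /andP[hg _] /andP[hg' _].
rewrite (clan_ofE hg) (clan_ofE hg') => /eqP; rewrite eq_clanE.
exact: inv_word_inj.
Qed.
End SignedInvolutionClans.

(** * The recurrence satisfied by the sum *)

Import GRing.Theory Num.Theory.
Local Open Scope ring_scope.

(* Terms with [m < 2 * r] vanish because the falling factorial does. *)
Definition hermite_term (m r : nat) : rat :=
  2%:R ^+ (m - 2 * r) * (m ^_ (2 * r))%:R / (r`!)%:R.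

Definition hermite_sum (N m : nat) : rat := \sum_(r < N) hermite_term m r.

(** With [k = m - 2 * r], removing the common factors leaves [m + 2 = k + 2 * (r + 1)]. If
    [m < 2 * r], all three terms vanish. *)
Lemma hermite_termS m r :
  hermite_term m.+2 r.+1 =
    2%:R * hermite_term m.+1 r.+1 + (2 * m.+1)%:R * hermite_term m r.
Proof.
rewrite /hermite_term mulnS !add2n.
have [lt|le] := ltnP m (2 * r).
  by rewrite !ffact_small // ?ltnS ?(ltnW lt) // !(mulr0, mul0r) addr0.
rewrite factS !subSS subnS !ffactSS ffactnSr.
move: (m - 2 * r)%N (subnK le) => k mE.
(* The factor [k] absorbs the truncated predecessor at [k = 0]. *)
have powE : 2%:R * 2%:R ^+ k.-1 * k%:R = 2%:R ^+ k * k%:R :> rat.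
  by case: k {mE} => [|k]; rewrite ?mulr0 // -exprS.
rewrite !natrM; have -> : (m.+2)%:R = k%:R + 2%:R * (r.+1)%:R :> rat.
  by rewrite -natrM -natrD -mE mulnS addnCA add2n.
have fn0 : (r`!)%:R != 0 :> rat by rewrite pnatr_eq0 -lt0n fact_gt0.
have rn0 : (r.+1)%:R != 0 :> rat by rewrite pnatr_eq0.
move: (k%:R : rat) (2%:R ^+ k.-1 : rat) (2%:R ^+ k : rat) powE fn0 rn0.
move: (r`!%:R : rat) (r.+1%:R : rat) ((m ^_ (2 * r))%:R : rat) (m.+1%:R : rat).
move=> f r1 F m1 K P' P powE fn0 rn0.
have -> : 2%:R * (P' * (m1 * (F * K)) / (r1 * f)) =
          (2%:R * P' * K) * m1 * F / (r1 * f) by field; apply/andP.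
by rewrite powE; field; apply/andP.
Qed.

(** The term at [r = 0] is a power of 2 and only doubles; the others follow [hermite_termS], whose
    index shift explains [N] in the last sum. *)
Lemma hermite_sum_rec N m :
  hermite_sum N.+1 m.+2 =
    2%:R * hermite_sum N.+1 m.+1 + (2 * m.+1)%:R * hermite_sum N m.
Proof.
have term0 k : hermite_term k 0 = 2%:R ^+ k.
  by rewrite /hermite_term muln0 subn0 ffactn0 mulr1 divr1.
rewrite /hermite_sum !big_ord_recl !term0 mulrDr -exprS -addrA; congr (_ + _).
rewrite !mulr_sumr -big_split /=.
by apply: eq_bigr => r _; apply: hermite_termS.
Qed.

Lemma hermite_sum_small N m : (m < 2)%N -> hermite_sum N.+1 m = 2%:R ^+ m.
Proof.
move=> m2; rewrite /hermite_sum big_ord_recl big1 ?addr0 => [|r _].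
  by rewrite /hermite_term muln0 subn0 ffactn0 mulr1 divr1.
rewrite /hermite_term ffact_small ?mulr0 ?mul0r //.
by apply: leq_trans m2 _; rewrite mulnS leq_addr.
Qed.

(** * Evaluation of the number of signed involutions *)

Section SignedInvolutionTotal.
Set Implicit Arguments.
Unset Strict Implicit.
Variable n : nat.
Implicit Types A : {set 'I_n}.

(** The factor 2 comes from the two equal parity classes; the term [b = a], where [a] is a fixed
    point, is split off. *)
Lemma signed_inv_total_rec A a : a \in A ->
  signed_inv_total A =
    (2 * (signed_inv_total (A :\ a) +
          \sum_(b in A :\ a) signed_inv_total (A :\ a :\ b)))%N.
Proof.
move=> aA; rewrite {1}/signed_inv_total !(@signed_inv_card_rec _ A a) // addnn.
rewrite -mul2n (bigD1 a) //=; congr (2 * (_ + _))%N.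
  congr signed_inv_total; apply/setP => i; rewrite !inE.
  by case: (i == a).
by apply: eq_bigl => b; rewrite !inE andbC.
Qed.

(** Induction on the size of [A]. The bound is stated for all [N] because removing two points lowers
    [N] by one. *)
Lemma signed_inv_totalE A N : (#|A| < 2 * N)%N ->
  (signed_inv_total A)%:R = hermite_sum N #|A|.
Proof.
have [m] := ubnP #|A|; elim: m A N => // m IH A [|N] //.
have [->|[a aA]] := set_0Vmem A.
  by rewrite signed_inv_total0 cards0 hermite_sum_small.
rewrite (signed_inv_total_rec aA) natrM natrD natr_sum.
rewrite (cardsD1 a A) aA add1n ltnS => cm cN.
rewrite (IH _ N.+1) //; last exact: ltnW.
have cb b : b \in A :\ a -> #|A :\ a| = #|A :\ a :\ b|.+1.
  by move=> bA; rewrite [LHS](cardsD1 b) bA.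
case Ec: #|A :\ a| => [|k]; rewrite Ec in cb cm cN.
  rewrite (cards0_eq Ec) big_set0 addr0 !hermite_sum_small //.
rewrite hermite_sum_rec mulrDr natrM -mulrA; congr (_ + _ * _).
rewrite (eq_bigr (fun=> hermite_sum N k)) => [|b bA].
  by rewrite sumr_const Ec mulr_natl.
have [Eb] := cb b bA; rewrite Eb; apply: IH; rewrite -Eb; first exact: ltnW.
by move: cN; rewrite mulnS add2n !ltnS.
Qed.

(** Nonemptiness supplies an element to remove, hence equal parity classes; on the empty set the
    total is 1. *)
Lemma signed_inv_cardE A e N : A != set0 -> (#|A| < 2 * N)%N ->
  (signed_inv_card A e)%:R = hermite_sum N #|A| / 2%:R.
Proof.
case/set0Pn => a aA lt; rewrite -signed_inv_totalE //.
have E e' : signed_inv_card A e' = signed_inv_card A e.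
  by rewrite !(@signed_inv_card_rec _ A a).
by rewrite /signed_inv_total !E addnn -muln2 natrM mulfK.
Qed.
End SignedInvolutionTotal.

(** * The closed formula *)

Lemma hermite_term_half m r : (2 * r <= m)%N ->
  hermite_term m r / 2%:R =
    (2%:R : rat) ^ (m%:Z - (2 * r)%N%:Z - 1) *
    ((m`!)%:R / ((r`!)%:R * ((m - 2 * r)`!)%:R)).
Proof.
(* The exponent is an integer since it equals -1 when [m = 2 * r]; the halving is split off as the
   power [-1]. *)
move=> le; rewrite expfzDr // subzn // /hermite_term.
have fn0 k : (k`!)%:R != 0 :> rat by rewrite pnatr_eq0 -lt0n fact_gt0.
rewrite -(ffact_fact le) natrM -exprnP.
rewrite [_ ^ (-1)]exprN1.
have := fn0 r; have := fn0 (m - 2 * r)%N => h1 h2.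
by field; rewrite h1 h2.
Qed.

Theorem proposition5p2 (n : nat) (hn : (1 <= n)%N) :
  (DIII_number n)%:R =
    \sum_(r < (n %/ 2).+1)
      (2%:R : rat) ^ (n%:Z - (2 * r)%N%:Z - 1) *
      ((n`!)%:R / ((r`!)%:R * ((n - 2 * r)`!)%:R)).
Proof.
(* The number of summands, [n %/ 2 + 1], is the least [N] with [n < 2 * N]. *)
have n2 : (#|[set: 'I_n]| < 2 * (n %/ 2).+1)%N.
  by rewrite cardsT card_ord mulnC -ltn_divLR.
have n0 : [set: 'I_n] != set0 by apply/set0Pn; exists (Ordinal hn).
rewrite DIII_number_signed_inv (signed_inv_cardE _ n0 n2) cardsT card_ord.
rewrite /hermite_sum mulr_suml; apply: eq_bigr => r _.
by apply: hermite_term_half; rewrite mulnC -leq_divRL // -ltnS ltn_ord.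
Qed.
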